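(* For generic $x_0,x_1,\dots,x_L$ (and $1\le i\le L$), \[ Z(X)=\det(V)\prod_{k=1}^L\frac{b(x_k-x_0)}{a(x_0-\mu_k)},\qquad Z(X_i^0)=\det(V_i)\prod_{k=1}^L\frac{b(x_k-x_0)}{a(x_0-\mu_k)}, \] where $V$ and $V_i$ are $L\times L$ matrices with, for $1\le\alpha,\beta\le L$, \[ V_{\alpha,\beta}=\begin{cases}\displaystyle\prod_{k=1}^Lb(x_\alpha-\mu_k)-\prod_{k=1}^La(x_\alpha-\mu_k)\prod_{\substack{k=0\\k\ne\alpha}}^L\frac{a(x_k-x_\alpha)}{b(x_k-x_\alpha)}&\beta=\alpha,\\[2ex] \dfrac{c(x_\beta-x_\alpha)}{b(x_\beta-x_\alpha)}\displaystyle\prod_{k=1}^La(x_\beta-\mu_k)\prod_{\substack{k=0\\k\ne\alpha,\beta}}^L\frac{a(x_k-x_\beta)}{b(x_k-x_\beta)}&\beta\ne\alpha,\end{cases} \] and $V_i$ equals $V$ except that its column $i$ is replaced by the column with entries \[ (V_i)_{\alpha,i}=\frac{c(x_\alpha-x_0)}{b(x_\alpha-x_0)}\prod_{k=1}^La(x_0-\mu_k)\prod_{\substack{k=1\\k\ne\alpha}}^L\frac{a(x_k-x_0)}{b(x_k-x_0)},\qquad 1\le\alpha\le L. \] In particular the right-hand side of the first formula is independent of $x_0$.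
   Context: Six-vertex setup. Fix $\gamma\in\mathbb C$, $L\ge1$ and $\mu_1,\dots,\mu_L\in\mathbb C$. Let $a(x)=\sinh(x+\gamma)$, $b(x)=\sinh x$, $c(x)=\sinh\gamma$ (constant). With $v_1,v_2$ the standard basis of $\mathbb C^2$, let $R(x)$ be the matrix on $\mathbb C^2\otimes\mathbb C^2$ which in the ordered basis $v_1\otimes v_1,v_1\otimes v_2,v_2\otimes v_1,v_2\otimes v_2$ is $\begin{pmatrix}a(x)&0&0&0\\0&b(x)&c(x)&0\\0&c(x)&b(x)&0\\0&0&0&a(x)\end{pmatrix}$. On $\mathbb C^2_0\otimes(\mathbb C^2)^{\otimes L}$, let $T_0(x)=R_{01}(x-\mu_1)R_{02}(x-\mu_2)\cdots R_{0L}(x-\mu_L)$ (with $R_{0i}$ acting on the auxiliary factor $0$ and quantum factor $i$), written in the auxiliary space as $\begin{pmatrix}A(x)&B(x)\\C(x)&D(x)\end{pmatrix}$. With $|0\rangle=v_1^{\otimes L}$ and $\langle\bar0|=(v_2^* )^{\otimes L}$, the partition function of the six-vertex model with domain-wall boundaries is $Z(x_1,\dots,x_L)=\langle\bar0|B(x_1)B(x_2)\cdots B(x_L)|0\rangle$. Notation: $X=(x_1,\dots,x_L)$; for $1\le i\le L$, $X_i^0$ is $X$ with $x_i$ replaced by $x_0$. *)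

(* Defs.v *)
From Stdlib Require Import Reals ClassicalEpsilon FunctionalExtensionality Lra Psatz.
From HB Require Import structures.
From mathcomp Require Import all_boot all_order all_algebra.

Set Implicit Arguments.
Unset Strict Implicit.
Unset Printing Implicit Defensive.

Inductive complex : Type := Cplx of R & R.

Definition Re (z : complex) : R := let: Cplx a _ := z in a.
Definition Im (z : complex) : R := let: Cplx _ b := z in b.

Definition complex_eqb (z w : complex) : bool :=
  let: Cplx a b := z in let: Cplx c d := w in
  if Req_EM_T a c then (if Req_EM_T b d then true else false) else false.

Lemma complex_eqP : Equality.axiom complex_eqb.
Proof.
move=> [a b] [c d] /=.
case: (Req_EM_T a c) => [e|h]; last by constructor; case.
case: (Req_EM_T b d) => [e'|h]; first by constructor; rewrite e e'.
by constructor; case.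
Qed.

HB.instance Definition _ := hasDecEq.Build complex complex_eqP.

Definition complex_find (P : pred complex) (n : nat) : option complex :=
  match excluded_middle_informative (exists x, P x) with
  | left H => Some (proj1_sig (constructive_indefinite_description _ H))
  | right _ => None
  end.

Lemma complex_find_correct P n x : complex_find P n = Some x -> P x.
Proof.
rewrite /complex_find; case: excluded_middle_informative => // H [<-].
exact: (proj2_sig (constructive_indefinite_description _ H)).
Qed.

Lemma complex_find_complete (P : pred complex) :
  (exists x, P x) -> exists n, complex_find P n.
Proof.
move=> H; exists 0%N; rewrite /complex_find.
by case: excluded_middle_informative.
Qed.

Lemma complex_find_ext (P Q : pred complex) :
  P =1 Q -> complex_find P =1 complex_find Q.
Proof.
move=> PQ n.
have -> : P = Q by apply: functional_extensionality.
by [].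
Qed.

HB.instance Definition _ :=
  hasChoice.Build complex complex_find_correct complex_find_complete
    complex_find_ext.

Definition Czero : complex := Cplx R0 R0.
Definition Cone : complex := Cplx R1 R0.
Definition Cadd (z w : complex) : complex :=
  Cplx (Rplus (Re z) (Re w)) (Rplus (Im z) (Im w)).
Definition Copp (z : complex) : complex := Cplx (Ropp (Re z)) (Ropp (Im z)).
Definition Cmul (z w : complex) : complex :=
  Cplx (Rminus (Rmult (Re z) (Re w)) (Rmult (Im z) (Im w)))
       (Rplus (Rmult (Re z) (Im w)) (Rmult (Im z) (Re w))).
Definition Cinv (z : complex) : complex :=
  let n := Rplus (Rmult (Re z) (Re z)) (Rmult (Im z) (Im z)) in
  Cplx (Rmult (Re z) (Rinv n)) (Ropp (Rmult (Im z) (Rinv n))).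

Lemma CaddA : associative Cadd.
Proof. by move=> [a b] [c d] [e f]; rewrite /Cadd /Czero /Copp /=; f_equal; ring. Qed.
Lemma CaddC : commutative Cadd.
Proof. by move=> [a b] [c d]; rewrite /Cadd /Czero /Copp /=; f_equal; ring. Qed.
Lemma Cadd0 : left_id Czero Cadd.
Proof. by move=> [a b]; rewrite /Cadd /Czero /Copp /=; f_equal; ring. Qed.
Lemma CaddN : left_inverse Czero Copp Cadd.
Proof. by move=> [a b]; rewrite /Cadd /Czero /Copp /=; f_equal; ring. Qed.

HB.instance Definition _ := GRing.isZmodule.Build complex CaddA CaddC Cadd0 CaddN.

Lemma CmulA : associative Cmul.
Proof. by move=> [a b] [c d] [e f]; rewrite /Cmul /Cone /=; f_equal; ring. Qed.
Lemma CmulC : commutative Cmul.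
Proof. by move=> [a b] [c d]; rewrite /Cmul /Cone /=; f_equal; ring. Qed.
Lemma Cmul1 : left_id Cone Cmul.
Proof. by move=> [a b]; rewrite /Cmul /Cone /=; f_equal; ring. Qed.
Lemma CmulDl : left_distributive Cmul Cadd.
Proof. by move=> [a b] [c d] [e f]; rewrite /Cmul /Cadd /=; f_equal; ring. Qed.
Lemma Cone_neq0 : Cone != Czero.
Proof.
apply/eqP; case=> h; exact: R1_neq_R0 h.
Qed.

HB.instance Definition _ :=
  GRing.Zmodule_isComNzRing.Build complex CmulA CmulC Cmul1 CmulDl Cone_neq0.

Lemma CmulV (z : complex) : z != 0%R -> Cmul (Cinv z) z = 1%R.
Proof.
case: z => a b /eqP nz.
have hn : Rplus (Rmult a a) (Rmult b b) <> R0.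
  move=> h; apply: nz.
  have ha : a = R0 by nra.
  have hb : b = R0 by nra.
  by rewrite ha hb.
change (Cmul (Cinv (Cplx a b)) (Cplx a b) = Cone).
rewrite /Cmul /Cinv /Cone /=; f_equal; field; exact: hn.
Qed.

Lemma Cinv0 : Cinv 0%R = 0%R.
Proof.
change (Cinv Czero = Czero); rewrite /Cinv /Czero /=.
have -> : Rplus (Rmult R0 R0) (Rmult R0 R0) = R0 by ring.
rewrite Rinv_0; congr Cplx; ring.
Qed.

HB.instance Definition _ := GRing.ComNzRing_isField.Build complex CmulV Cinv0.

Definition Cexp (z : complex) : complex :=
  Cplx (Rmult (exp (Re z)) (cos (Im z))) (Rmult (exp (Re z)) (sin (Im z))).

Local Open Scope ring_scope.

Definition Csinh (z : complex) : complex := (Cexp z - Cexp (- z)) / 2%:R.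

Definition aw (gamma x : complex) : complex := Csinh (x + gamma).
Definition bw (x : complex) : complex := Csinh x.
Definition cw (gamma x : complex) : complex := Csinh gamma.

Unset Implicit Arguments.

(* Basis of C^2: v_1 <-> false, v_2 <-> true.
   Entry of R(x) in row v_a (x) v_s, column v_b (x) v_t. *)
Definition Rentry (gamma x : complex) (a s b t : bool) : complex :=
  if (a == b) && (s == t) then (if a == s then aw gamma x else bw x)
  else if [&& a == t, s == b & a != s] then cw gamma x else 0.

(* Quantum space (C^2)^{(x) L}: basis vectors indexed by the finite
   functions sigma : 'I_L -> bool (site n+1 carries v_{sigma n}).
   Operators on it are given by their matrix entries  O sigma tau
   (row sigma = output basis vector, column tau = input).           *)
Definition qstate (L : nat) := {ffun 'I_L -> bool}.
Definition qop (L : nat) := qstate L -> qstate L -> complex.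

Definition qop_mul L (P Q : qop L) : qop L :=
  fun s t => \sum_(r : qstate L) P s r * Q r t.
Definition qop_id L : qop L := fun s t => (s == t)%:R.

(* Auxiliary-space entry (a,b) of the monodromy matrix
   T_0(x) = R_01(x - mu_1) R_02(x - mu_2) ... R_0L(x - mu_L),
   an operator on the quantum space. The sum is over the auxiliary
   indices k_0 = a, k_1, ..., k_L = b between the consecutive factors;
   factor n+1 (acting on site n+1) has spectral parameter x - mu (n+1). *)
Definition monodromy_entry (L : nat) (gamma : complex) (mu : nat -> complex)
    (x : complex) (a b : bool) : qop L :=
  fun sigma tau =>
    \sum_(k : {ffun 'I_L.+1 -> bool} | (k ord0 == a) && (k ord_max == b))
      \prod_(n < L)
        Rentry gamma (x - mu n.+1)
          (k (widen_ord (leqnSn L) n)) (sigma n)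
          (k (lift ord0 n)) (tau n).

(* T_0(x) = [[A(x), B(x)], [C(x), D(x)]]: B is the (v_1, v_2) entry. *)
Definition Bop (L : nat) (gamma : complex) (mu : nat -> complex)
    (x : complex) : qop L := monodromy_entry L gamma mu x false true.

Definition vac (L : nat) : qstate L := [ffun _ => false].
Definition dualvac (L : nat) : qstate L := [ffun _ => true].

(* Domain-wall partition function
   Z(x_1,...,x_L) = <0bar| B(x_1) B(x_2) ... B(x_L) |0>,
   the x's being read off a sequence X at indices 1..L. *)
Definition Zdw (L : nat) (gamma : complex) (mu X : nat -> complex) : complex :=
  (\big[qop_mul L/qop_id L]_(1 <= j < L.+1) Bop L gamma mu (X j))
    (dualvac L) (vac L).

Definition replace0 (X : nat -> complex) (i : nat) : nat -> complex :=
  fun k => if k == i then X 0%N else X k.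

(* The matrix V (L x L); the row/column index alpha : 'I_L stands for
   the paper's index alpha.+1 in 1..L. *)
Definition Vmx (L : nat) (gamma : complex) (mu x : nat -> complex) : 'M_L :=
  \matrix_(al < L, be < L)
    let a := al.+1 in let b := be.+1 in
    if a == b then
      \prod_(1 <= k < L.+1) bw (x a - mu k)
      - \prod_(1 <= k < L.+1) aw gamma (x a - mu k)
        * \prod_(0 <= k < L.+1 | k != a)
            (aw gamma (x k - x a) / bw (x k - x a))
    else
      cw gamma (x b - x a) / bw (x b - x a)
      * \prod_(1 <= k < L.+1) aw gamma (x b - mu k)
      * \prod_(0 <= k < L.+1 | (k != a) && (k != b))
          (aw gamma (x k - x b) / bw (x k - x b)).

Definition Vimx (L : nat) (gamma : complex) (mu x : nat -> complex) (i : nat)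
    : 'M_L :=
  \matrix_(al < L, be < L)
    let a := al.+1 in
    if be.+1 == i then
      cw gamma (x a - x 0%N) / bw (x a - x 0%N)
      * \prod_(1 <= k < L.+1) aw gamma (x 0%N - mu k)
      * \prod_(1 <= k < L.+1 | k != a)
          (aw gamma (x k - x 0%N) / bw (x k - x 0%N))
    else Vmx L gamma mu x al be.

Definition prefactor (L : nat) (gamma : complex) (mu x : nat -> complex)
    : complex :=
  \prod_(1 <= k < L.+1) (bw (x k - x 0%N) / aw gamma (x 0%N - mu k)).

(* Main.v *)
(** Writing s = sinh, d(z) = prod_k b(z - mu_k) and a(z) = prod_k a(z - mu_k), let
    D f(z) = d(z) s(z - x_0) f(z) + a(z) s(x_0 - z + gamma) f(z - gamma).  For
    all trigonometric polynomials g_1, ..., g_L of degree L - 1 and distinct points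
    y_1, ..., y_L,

      det (D g_j (y_i)) = Z(y) * prod_k a(x_0 - mu_k) * det (g_j (y_i)).

    Both sides are multilinear in the g_j, so any basis will do, and both have
    degree L in mu_1, so L + 1 values of mu_1 suffice.  At mu_1 = y_i the identity
    reduces to L - 1: on the left choose a basis all but one of whose members
    vanish at y_i - gamma; on the right use that Z is symmetric (the B's commute)
    together with its first-site recursion.  At mu_1 = x_0 + gamma both sides vanish,
    since prod_{k > 1} a(z - mu_k) is annihilated by D.  These L + 1 points are distinct
    for generic x_0; a second interpolation, in x_0, removes this restriction.

    With g_j the nodal polynomials prod_{k <> j} s(z - x_k), the matrix D g_j (y_i) is
    the transpose of V (if y = X) or V_i (if y = X_i^0) up to row factors. *)

From Stdlib Require Import Reals Lra FunctionalExtensionality.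
Require Import Defs.
From mathcomp Require Import all_boot all_order all_algebra.
From mathcomp Require Import fingroup perm ring.
Import GRing.Theory.
Local Open Scope ring_scope.

(** * Complex exponential and hyperbolic sine *)

Lemma CexpD (z w : complex) : Cexp (z + w) = Cexp z * Cexp w.
Proof.
case: z w => [a b] [c d].
change (Cexp (Cadd (Cplx a b) (Cplx c d))
        = Cmul (Cexp (Cplx a b)) (Cexp (Cplx c d))).
rewrite /Cexp /Cadd /Cmul /= exp_plus cos_plus sin_plus.
by congr Cplx; lra.
Qed.

Lemma Cexp0 : Cexp 0 = 1.
Proof.
change (Cexp (Cplx R0 R0) = Cplx R1 R0).
by rewrite /Cexp /= exp_0 cos_0 sin_0; congr Cplx; lra.
Qed.

Lemma Cexp_neq0 (z : complex) : Cexp z != 0.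
Proof.
apply/eqP => z0; have /eqP := oner_neq0 complex; apply.
by rewrite -Cexp0 -[in LHS](subrr z) CexpD z0 mul0r.
Qed.

Lemma CexpN (z : complex) : Cexp (- z) = (Cexp z)^-1.
Proof.
by apply: (mulfI (Cexp_neq0 z)); rewrite -CexpD subrr Cexp0 divff ?Cexp_neq0.
Qed.

Lemma CexpB (z w : complex) : Cexp (z - w) = Cexp z / Cexp w.
Proof. by rewrite CexpD CexpN. Qed.

Lemma complex2_neq0 : 2%:R != 0 :> complex.
Proof.
apply/eqP => /(f_equal Re); change (Rplus R1 R1 = R0 -> False); lra.
Qed.

Lemma CsinhE (z : complex) : Csinh z = (Cexp z - (Cexp z)^-1) / 2%:R.
Proof. by rewrite /Csinh CexpN. Qed.

Lemma CsinhN (z : complex) : Csinh (- z) = - Csinh z.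
Proof. by rewrite /Csinh opprK -mulNr opprB. Qed.

Lemma Csinh0 : Csinh 0 = 0.
Proof. by rewrite CsinhE Cexp0 invr1 subrr mul0r. Qed.

(** A zero of sinh has $e^{2z}=1$, whereas here $|e^{2z}|=e^{2\,\mathrm{Re}\,z}>1$. *)
Lemma Csinh_neq0 (z : complex) : Rlt R0 (Re z) -> Csinh z != 0.
Proof.
move=> z_gt0; apply/eqP; rewrite CsinhE => /eqP.
have z0 := Cexp_neq0 z.
rewrite mulf_eq0 invr_eq0 (negPf complex2_neq0) orbF subr_eq0 => /eqP e.
have : Cexp (z + z) = 1 by rewrite CexpD {1}e mulVf.
case: z z_gt0 {z0 e} => a b /= a_gt0.
change (Cexp (Cadd (Cplx a b) (Cplx a b)) = Cplx R1 R0 -> False).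
rewrite /Cexp /Cadd /= => -[].
have := exp_ineq1 (Rplus a a); have := sin2_cos2 (Rplus b b); rewrite /Rsqr.
move: (exp _) (sin _) (cos _) => E s c sc Egt e1 e2.
by have := Egt; nra.
Qed.

(** Interpolation nodes are compared through $e^{2z}$; a coincidence of nodes becomes a zero of
    sinh. *)
Lemma exp2_eq (z w : complex) : Cexp z ^+ 2 = Cexp w ^+ 2 -> Csinh (z - w) = 0.
Proof.
move=> e; rewrite CsinhE CexpB.
have z0 := Cexp_neq0 z; have w0 := Cexp_neq0 w; have c2 := complex2_neq0.
have -> : Cexp z / Cexp w - (Cexp z / Cexp w)^-1
   = (Cexp z ^+ 2 - Cexp w ^+ 2) / (Cexp z * Cexp w) by field; rewrite z0 w0.
by rewrite e subrr !mul0r.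
Qed.

(** * Trigonometric polynomials and interpolation *)

(* Trigonometric polynomials of degree at most [n] and parity [n]. *)
Definition trigpoly (n : nat) (f : complex -> complex) :=
  exists2 p : {poly complex}, (size p <= n.+1)%N &
    forall z, f z = p.[Cexp z ^+ 2] / Cexp z ^+ n.

Lemma eq_trigpoly n f g : f =1 g -> trigpoly n f -> trigpoly n g.
Proof. by move=> fg [p sp fp]; exists p => // z; rewrite -fg fp. Qed.

Lemma trigpoly0 n : trigpoly n (fun=> 0).
Proof. by exists 0 => [|z]; rewrite ?size_poly0 // horner0 mul0r. Qed.

Lemma trigpolyD n f g :
  trigpoly n f -> trigpoly n g -> trigpoly n (fun z => f z + g z).
Proof.
move=> [p sp fp] [q sq gq]; exists (p + q) => [|z].
  by rewrite (leq_trans (size_polyD _ _)) // geq_max sp sq.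
by rewrite fp gq hornerD mulrDl.
Qed.

Lemma trigpolyM m n f g :
  trigpoly m f -> trigpoly n g -> trigpoly (m + n) (fun z => f z * g z).
Proof.
move=> [p sp fp] [q sq gq]; exists (p * q) => [|z].
  rewrite (leq_trans (size_polyMleq _ _)) // -subn1 leq_subLR.
  by rewrite (leq_trans (leq_add sp sq)) // !addnS addSn.
by rewrite fp gq hornerM exprD invfM mulrACA.
Qed.

Lemma trigpoly_const c : trigpoly 0 (fun=> c).
Proof.
by exists c%:P => [|z]; rewrite ?(leq_trans (size_polyC_leq1 _)) // hornerC divr1.
Qed.

Lemma trigpolyZ n c f : trigpoly n f -> trigpoly n (fun z => c * f z).
Proof. exact: trigpolyM (trigpoly_const c). Qed.

Lemma trigpolyN n f : trigpoly n f -> trigpoly n (fun z => - f z).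
Proof. by move/(trigpolyZ n (-1)); apply: eq_trigpoly => z; rewrite mulN1r. Qed.

Lemma trigpoly_sum n I (r : seq I) (f : I -> complex -> complex) :
  (forall i, trigpoly n (f i)) -> trigpoly n (fun z => \sum_(i <- r) f i z).
Proof.
move=> fT; elim: r => [|i r IHr].
  by apply: eq_trigpoly (trigpoly0 n) => z; rewrite big_nil.
by apply: eq_trigpoly (trigpolyD _ _ _ (fT i) IHr) => z; rewrite big_cons.
Qed.

Lemma trigpoly_prod I (r : seq I) (P : pred I) (f : I -> complex -> complex) :
  (forall i, P i -> trigpoly 1 (f i)) ->
  trigpoly (count P r) (fun z => \prod_(i <- r | P i) f i z).
Proof.
move=> fT; elim: r => [|i r IHr].
  by apply: eq_trigpoly (trigpoly_const 1) => z; rewrite big_nil.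
have [Pi|nPi] := boolP (P i); rewrite /= ?Pi ?(negPf nPi).
  by apply: eq_trigpoly (trigpolyM _ _ _ _ (fT i Pi) IHr) => z; rewrite big_cons Pi.
by apply: eq_trigpoly IHr => z; rewrite big_cons (negPf nPi).
Qed.

Lemma trigpoly_prod_ord n (f : 'I_n -> complex -> complex) :
  (forall i, trigpoly 1 (f i)) -> trigpoly n (fun z => \prod_i f i z).
Proof.
move=> fT; have := trigpoly_prod _ (index_enum 'I_n) xpredT f (fun i _ => fT i).
rewrite count_predT (_ : size _ = n) //.
by rewrite -[index_enum _]enumT size_enum_ord.
Qed.

Lemma trigpoly_det n (M : complex -> 'M[complex]_n) :
  (forall i j, trigpoly 1 (fun z => M z i j)) -> trigpoly n (fun z => \det (M z)).
Proof.
move=> MT; apply: trigpoly_sum => s; apply: trigpolyZ.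
by apply: (trigpoly_prod_ord n (fun i z => M z i (s i))) => i.
Qed.

Lemma trigpoly_sinh_add w : trigpoly 1 (fun z => Csinh (z + w)).
Proof.
exists ((Cexp w / 2%:R) *: 'X + (- (Cexp w)^-1 / 2%:R)%:P) => [|z].
  rewrite (leq_trans (size_polyD _ _)) // geq_max (leq_trans (size_scale_leq _ _)) ?size_polyX //.
  by rewrite (leq_trans (size_polyC_leq1 _)).
rewrite CsinhE CexpD hornerD hornerZ hornerX hornerC expr1.
have z0 := Cexp_neq0 z; have w0 := Cexp_neq0 w; have c2 := complex2_neq0.
by field; rewrite z0 w0 c2.
Qed.

Lemma trigpoly_sinh_sub w : trigpoly 1 (fun z => Csinh (w - z)).
Proof.
apply: eq_trigpoly (trigpolyN _ _ (trigpoly_sinh_add (- w))) => z.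
by rewrite -CsinhN opprB.
Qed.

(** The points $e^{2z}$ are distinct roots of [p], and a nonzero [p] of degree at most [n] has at
    most [n] roots. *)
Lemma trigpoly_eq0 n f (s : seq complex) :
  trigpoly n f -> uniq [seq Cexp z ^+ 2 | z <- s] -> (n < size s)%N ->
  (forall z, z \in s -> f z = 0) -> forall z, f z = 0.
Proof.
move=> [p sp fp] us ns fs z; rewrite fp.
suff -> : p = 0 by rewrite horner0 mul0r.
apply: contraTeq ns => p0; rewrite -leqNgt.
have := max_poly_roots p0 _ us; rewrite size_map => H.
rewrite -ltnS (leq_trans (H _) sp) //.
apply/allP => _ /mapP [w ws ->]; apply/rootP.
have /eqP := fs w ws; rewrite fp mulf_eq0 invr_eq0 expf_eq0 (negPf (Cexp_neq0 w)) andbF orbF.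
by move/eqP.
Qed.

(** * Splitting off the first site *)

(** Serves both for configurations of the quantum space and for paths of auxiliary indices. *)
Definition scons n (b : bool) (s : {ffun 'I_n -> bool}) : {ffun 'I_n.+1 -> bool} :=
  [ffun i => oapp s b (unlift ord0 i)].
Arguments scons {n}.

Lemma scons0 n b (s : {ffun 'I_n -> bool}) : scons b s ord0 = b.
Proof. by rewrite ffunE unlift_none. Qed.

Lemma sconsS n b (s : {ffun 'I_n -> bool}) i : scons b s (lift ord0 i) = s i.
Proof. by rewrite ffunE liftK. Qed.

Lemma scons_eq n a b (s t : {ffun 'I_n -> bool}) :
  (scons a s == scons b t) = (a == b) && (s == t).
Proof.
apply/eqP/andP => [e|[/eqP-> /eqP->] //]; split; apply/eqP.
  by rewrite -(scons0 _ a s) e scons0.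
by apply/ffunP => i; rewrite -(sconsS _ a s) e sconsS.
Qed.

Lemma scons_eta n (r : {ffun 'I_n.+1 -> bool}) :
  scons (r ord0) [ffun i => r (lift ord0 i)] = r.
Proof.
by apply/ffunP => i; rewrite ffunE; case: unliftP => [j|] -> //=; rewrite ffunE.
Qed.

Lemma scons_max n b (s : {ffun 'I_n.+1 -> bool}) : scons b s ord_max = s ord_max.
Proof. by rewrite -[RHS](sconsS _ b s); congr (scons b s _); apply: val_inj. Qed.

Lemma sum_scons n (P : pred {ffun 'I_n.+1 -> bool}) (F : {ffun 'I_n.+1 -> bool} -> complex) :
  \sum_(r | P r) F r
  = \sum_(b : bool) \sum_(s : {ffun 'I_n -> bool} | P (scons b s)) F (scons b s).
Proof.
rewrite pair_big_dep /=.
apply: (reindex (fun p : bool * {ffun 'I_n -> bool} => scons p.1 p.2)).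
exists (fun r : {ffun 'I_n.+1 -> bool} => (r ord0, [ffun i => r (lift ord0 i)]))
  => [[b s] _|r _] /=.
  by rewrite scons0; congr pair; apply/ffunP => i; rewrite ffunE sconsS.
exact: scons_eta.
Qed.

Lemma sum_bool (F : bool -> complex) : \sum_b F b = F false + F true.
Proof. by rewrite big_bool addrC. Qed.

(* The monodromy matrix with the inhomogeneities indexed from [0], so that
   splitting off the first site shifts [m] by one. *)
Definition monodromy L gamma (m : nat -> complex) x (a b : bool) : qop L :=
  monodromy_entry L gamma (fun k => m k.-1) x a b.

(** The monodromy matrix is $R_{01}$ times that of the remaining sites; [c] is the auxiliary index
    between the two. *)
Lemma monodromyS L gamma m x a b s t sigma tau :
  monodromy L.+1 gamma m x a b (scons s sigma) (scons t tau)
  = \sum_(c : bool) Rentry gamma (x - m 0%N) a s c t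
      * monodromy L gamma (fun k => m k.+1) x c b sigma tau.
Proof.
rewrite /monodromy /monodromy_entry sum_scons (bigD1 a) //= [X in _ + X]big1 ?addr0; last first.
  by move=> c ca; rewrite big_pred0 // => k; rewrite scons0 (negPf ca).
rewrite (partition_big (fun k : {ffun 'I_L.+1 -> bool} => k ord0) xpredT) //=.
apply: eq_bigr => c _; rewrite big_distrr /=.
apply: eq_big => [k|k /andP[_ /eqP kc]].
  by rewrite scons0 eqxx scons_max andbC.
rewrite big_ord_recl /=; congr (_ * _).
  rewrite -kc sconsS !scons0; congr (Rentry _ _ _ _ _ _).
  by rewrite -[RHS](scons0 _ a k); congr (scons a k _); apply: val_inj.
apply: eq_bigr => i _; rewrite !sconsS; congr (Rentry _ _ _ _ _ _).
by rewrite -(sconsS _ a k); congr (scons a k _); apply: val_inj.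
Qed.

Lemma monodromy0 gamma m x a b sigma tau :
  monodromy 0 gamma m x a b sigma tau = (a == b)%:R.
Proof.
rewrite /monodromy /monodromy_entry sum_scons (bigD1 a) //= [X in _ + X]big1 ?addr0; last first.
  by move=> c ca; rewrite big_pred0 // => k; rewrite scons0 (negPf ca).
have e (k : {ffun 'I_0 -> bool}) : scons a k ord_max = a by rewrite (ord1 ord_max) scons0.
under eq_bigl => k do rewrite scons0 eqxx e /=.
under eq_bigr => k _ do rewrite big_ord0.
case: eqP => _; last by rewrite big_pred0.
by rewrite sumr_const card_ffun card_ord.
Qed.

Lemma qop_mul_monodromyS L gamma m x y a a' s t sigma tau :
  let m' k := m k.+1 in
  qop_mul L.+1 (monodromy L.+1 gamma m x a true) (monodromy L.+1 gamma m y a' true)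
    (scons s sigma) (scons t tau)
  = \sum_(r : bool) \sum_(c : bool) \sum_(c' : bool)
      Rentry gamma (x - m 0%N) a s c r * Rentry gamma (y - m 0%N) a' r c' t
      * qop_mul L (monodromy L gamma m' x c true) (monodromy L gamma m' y c' true)
          sigma tau.
Proof.
move=> m'; rewrite /qop_mul sum_scons; apply: eq_bigr => r _.
under eq_bigr => rho _ do rewrite !monodromyS big_distrl /=.
rewrite exchange_big; apply: eq_bigr => c _ /=.
under eq_bigr => rho _ do rewrite big_distrr /=.
rewrite exchange_big; apply: eq_bigr => c' _ /=.
by rewrite big_distrr; apply: eq_bigr => rho _; rewrite /= mulrACA.
Qed.

(** * Exchange relations of the Yang-Baxter algebra *)

(** Reduces an identity to an explicit combination of two known ones; what remains is rational in
    exponentials, for [sinh_field]. *)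
Lemma eq_lincomb (k1 : complex) {l1 r1} (e1 : l1 = r1) k2 {l2 r2} (e2 : l2 = r2) a b :
  a - b = k1 * (l1 - r1) + k2 * (l2 - r2) -> a = b.
Proof.
by rewrite e1 e2 !subrr !mulr0 addr0 => /eqP; rewrite subr_eq0 => /eqP.
Qed.

Ltac sinh_field :=
  rewrite /aw /bw /cw !(CsinhE, CexpD, CexpN, mul0r, addr0, add0r);
  field; rewrite ?(Cexp_neq0, complex2_neq0, oner_neq0) //.

Definition mono2 L gamma m x y a a' :=
  qop_mul L (monodromy L gamma m x a true) (monodromy L gamma m y a' true).
Arguments mono2 : clear implicits.

(* For fixed [x] and [y] the family in [w] spans the two exchange relations of the
   Yang-Baxter algebra between [B] and [D]; stated this way they are preserved
   by adding a site without dividing by [a(x - y)], which may vanish. *)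
Lemma monodromy_exchange L gamma m x y sigma tau :
  let P := mono2 L gamma m in
  [/\ P x y false false sigma tau = P y x false false sigma tau,
      P x y true true sigma tau = P y x true true sigma tau &
      forall w, Csinh (x - w) * P x y false true sigma tau
                + Csinh (y - w + gamma) * P x y true false sigma tau
              = Csinh (y - w) * P y x false true sigma tau
                + Csinh (x - w + gamma) * P y x true false sigma tau].
Proof.
elim: L m sigma tau => [|L IHL] m sigma tau P.
  have one : monodromy 0 gamma m = fun _ a b _ _ => (a == b)%:R.
    by do 5!apply: functional_extensionality => ?; exact: monodromy0.
  rewrite /P /mono2 /qop_mul !one //=; split => // w.
  by rewrite !big1 ?mulr0 // => r _; rewrite ?mul0r ?mulr0.
rewrite -(scons_eta _ sigma) -(scons_eta _ tau).
move: (sigma ord0) (tau ord0) [ffun i => _] [ffun i => _] => s t {}tau {}sigma.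
have [BB DD BD] := IHL (fun k => m k.+1) sigma tau.
rewrite /P /mono2 !qop_mul_monodromyS !sum_bool -![qop_mul L _ _]/(mono2 L gamma _ _ _ _ _).
move: BB DD BD.
set ff := mono2 _ _ _ x y false false _ _; set tt := mono2 _ _ _ x y true true _ _.
set ft := mono2 _ _ _ x y false true _ _; set tf := mono2 _ _ _ x y true false _ _.
set ff' := mono2 _ _ _ y x false false _ _; set tt' := mono2 _ _ _ y x true true _ _.
set ft' := mono2 _ _ _ y x false true _ _; set tf' := mono2 _ _ _ y x true false _ _.
move=> <- <- BD.
rewrite /Rentry; case: s; case: t => /=; split=> [||w]; rewrite ?(mul0r,mulr0,addr0,add0r).
- by rewrite [bw _ * bw _]mulrC.
- by rewrite [aw _ _ * aw _ _]mulrC.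
(* In the hypothesis taken at $w=x$ the term in [ft] has coefficient $\sinh 0$. *)
- refine (eq_lincomb (bw (x - m 0%N) * aw gamma (y - m 0%N)) (BD w)
            (cw gamma 0 * Csinh (y - w)) (BD x) _ _ _).
  by sinh_field.
(* For row state $v_2$ and column state $v_1$ on the new site, the $BB$ relation is $c$ times the
   mixed one at $w=m_0$. *)
- refine (eq_lincomb (cw gamma 0) (BD (m 0%N)) 0 (BD x) _ _ _); sinh_field.
- by [].
- by sinh_field.
- by [].
(* At this [w], $\sinh(x-w)=-a(y-m_0)$ and $\sinh(y-w+\gamma)=-b(x-m_0)$, which are the weights in
   the $DD$ relation up to $-c$. *)
- refine (eq_lincomb (- cw gamma 0) (BD (x + y + gamma - m 0%N)) 0 (BD x) _ _ _).
  by sinh_field.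
- by sinh_field.
- by rewrite [aw _ _ * aw _ _]mulrC.
- by rewrite [bw _ * bw _]mulrC.
(* At $w=x+\gamma$ it is the term in [tf'] that drops out. *)
- refine (eq_lincomb (aw gamma (x - m 0%N) * bw (y - m 0%N)) (BD w)
            (- cw gamma 0 * Csinh (y - w + gamma)) (BD (x + gamma)) _ _ _).
  by sinh_field.
Qed.

(** * Products of $B$ operators and their symmetry *)

Lemma qop_mulA L : associative (qop_mul L).
Proof.
move=> P Q S; apply: functional_extensionality => s; apply: functional_extensionality => t.
rewrite /qop_mul; under eq_bigr => r _ do rewrite big_distrr /=.
rewrite exchange_big; apply: eq_bigr => r _ /=; rewrite big_distrl.
by apply: eq_bigr => u _; rewrite /= mulrA.
Qed.

Lemma qop_mul1 L : left_id (qop_id L) (qop_mul L).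
Proof.
move=> P; apply: functional_extensionality => s; apply: functional_extensionality => t.
rewrite /qop_mul /qop_id (bigD1 s) //= eqxx mul1r big1 ?addr0 // => r /negPf rs.
by rewrite eq_sym rs mul0r.
Qed.

Lemma qop_mulr1 L : right_id (qop_id L) (qop_mul L).
Proof.
move=> P; apply: functional_extensionality => s; apply: functional_extensionality => t.
rewrite /qop_mul /qop_id (bigD1 t) //= eqxx mulr1 big1 ?addr0 // => r /negPf rt.
by rewrite rt mulr0.
Qed.

Definition Bprod L gamma m (l : seq complex) : qop L :=
  foldr (fun x => qop_mul L (monodromy L gamma m x false true)) (qop_id L) l.

Lemma Bprod_cat L gamma m l1 l2 :
  Bprod L gamma m (l1 ++ l2) = qop_mul L (Bprod L gamma m l1) (Bprod L gamma m l2).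
Proof. by elim: l1 => [|x l IHl] /=; rewrite ?qop_mul1 // IHl qop_mulA. Qed.

Lemma monodromy_Bcomm L gamma m x y :
  qop_mul L (monodromy L gamma m x false true) (monodromy L gamma m y false true)
  = qop_mul L (monodromy L gamma m y false true) (monodromy L gamma m x false true).
Proof.
apply: functional_extensionality => s; apply: functional_extensionality => t.
by case: (monodromy_exchange L gamma m x y s t).
Qed.

Lemma Bprod_comm L gamma m l1 l2 :
  qop_mul L (Bprod L gamma m l1) (Bprod L gamma m l2)
  = qop_mul L (Bprod L gamma m l2) (Bprod L gamma m l1).
Proof.
have comm1 x l : qop_mul L (monodromy L gamma m x false true) (Bprod L gamma m l)
               = qop_mul L (Bprod L gamma m l) (monodromy L gamma m x false true).
  elim: l => [|y l IHl] /=; first by rewrite qop_mul1 qop_mulr1.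
  by rewrite qop_mulA monodromy_Bcomm -!qop_mulA IHl.
elim: l1 => [|x l IHl] /=; first by rewrite qop_mul1 qop_mulr1.
by rewrite -qop_mulA IHl qop_mulA comm1 qop_mulA.
Qed.

Lemma perm_Bprod L gamma m l1 l2 :
  perm_eq l1 l2 -> Bprod L gamma m l1 = Bprod L gamma m l2.
Proof.
move=> e; pose C l := Bprod L gamma m l1 = Bprod L gamma m l.
apply: (catCA_perm_ind (P := C) _ e) => // s1 s2 s3.
by rewrite /C !Bprod_cat !qop_mulA (Bprod_comm _ _ _ s1).
Qed.

(** * Recursion in the first inhomogeneity *)

Lemma monodromyB_ff L gamma m x sigma tau :
  monodromy L.+1 gamma m x false true (scons false sigma) (scons false tau)
  = aw gamma (x - m 0%N) * monodromy L gamma (fun k => m k.+1) x false true sigma tau.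
Proof. by rewrite monodromyS sum_bool /Rentry /= mul0r addr0. Qed.

Lemma monodromyB_tt L gamma m x sigma tau :
  monodromy L.+1 gamma m x false true (scons true sigma) (scons true tau)
  = bw (x - m 0%N) * monodromy L gamma (fun k => m k.+1) x false true sigma tau.
Proof. by rewrite monodromyS sum_bool /Rentry /= mul0r addr0. Qed.

Lemma monodromyB_ft L gamma m x sigma tau :
  monodromy L.+1 gamma m x false true (scons false sigma) (scons true tau) = 0.
Proof. by rewrite monodromyS sum_bool /Rentry /= !mul0r addr0. Qed.

Lemma monodromyB_tf L gamma m x sigma tau :
  monodromy L.+1 gamma m x false true (scons true sigma) (scons false tau)
  = Csinh gamma * monodromy L gamma (fun k => m k.+1) x true true sigma tau.
Proof. by rewrite monodromyS sum_bool /Rentry /= mul0r add0r. Qed.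

(** By [monodromyB_ft] the first site stays in state $v_1$ throughout, and each factor contributes a
    weight $a$. *)
Lemma Bprod_ff L gamma m l sigma tau :
  Bprod L.+1 gamma m l (scons false sigma) (scons false tau)
  = (\prod_(x <- l) aw gamma (x - m 0%N))
    * Bprod L gamma (fun k => m k.+1) l sigma tau.
Proof.
elim: l sigma => [|x l IHl] sigma /=.
  by rewrite big_nil mul1r /qop_id scons_eq.
rewrite big_cons /qop_mul sum_scons sum_bool /=.
rewrite [X in _ + X]big1 ?addr0 => [|r _]; last by rewrite monodromyB_ft mul0r.
rewrite mulr_sumr; apply: eq_bigr => r _.
by rewrite monodromyB_ff IHl; ring.
Qed.

(** The first site flips exactly once: either within [l], and $B(x)$ contributes $b$, or at $B(x)$,
    which contributes $c$ and leaves a $D$ on the other sites. *)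
Lemma Bprod_tf L gamma m x l sigma tau :
  Bprod L.+1 gamma m (x :: l) (scons true sigma) (scons false tau)
  = bw (x - m 0%N)
      * (\sum_rho monodromy L gamma (fun k => m k.+1) x false true sigma rho
           * Bprod L.+1 gamma m l (scons true rho) (scons false tau))
    + Csinh gamma * (\prod_(y <- l) aw gamma (y - m 0%N))
      * qop_mul L (monodromy L gamma (fun k => m k.+1) x true true)
          (Bprod L gamma (fun k => m k.+1) l) sigma tau.
Proof.
rewrite /= {1}/qop_mul sum_scons sum_bool /= addrC; congr (_ + _); rewrite mulr_sumr.
  by apply: eq_bigr => r _; rewrite monodromyB_tt mulrA.
by apply: eq_bigr => r _; rewrite monodromyB_tf Bprod_ff; ring.
Qed.

(** Isolates the first inhomogeneity as the variable of interpolation. *)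
Definition consn (u : complex) (m : nat -> complex) (k : nat) : complex :=
  if k is k'.+1 then m k' else u.

(** The degree is one less than the number of operators, since the one that flips the first site
    contributes the constant $c$. *)
Lemma trigpoly_Bprod_tf L gamma m x l sigma tau :
  trigpoly (size l)
    (fun u => Bprod L.+1 gamma (consn u m) (x :: l) (scons true sigma) (scons false tau)).
Proof.
have aT s : trigpoly (size s) (fun u => \prod_(y <- s) aw gamma (y - u)).
  rewrite -(count_predT s).
  apply: trigpoly_prod => y _; apply: eq_trigpoly (trigpoly_sinh_sub (y + gamma)) => u.
  by rewrite /aw addrAC.
elim: l x sigma => [|y l IHl] x sigma.
  apply: eq_trigpoly (trigpolyD _ _ _ (trigpoly0 0) (trigpolyZ _ (Csinh gamma
     * qop_mul L (monodromy L gamma m x true true) (Bprod L gamma m [::]) sigma tau) _ (aT [::]))) => u.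
  rewrite Bprod_tf [X in bw _ * X]big1 => [|r _]; first by rewrite mulr0 !add0r mulrAC.
  by rewrite /= /qop_id scons_eq mulr0.
pose T := trigpolyM 1 (size l) _ _ (trigpoly_sinh_sub x)
  (trigpoly_sum _ _ (index_enum (qstate L)) _ (fun rho => trigpolyZ _
     (monodromy L gamma m x false true sigma rho) _ (IHl y rho))).
apply: eq_trigpoly (trigpolyD _ _ _ T (trigpolyZ _ (Csinh gamma
   * qop_mul L (monodromy L gamma m x true true) (Bprod L gamma m (y :: l)) sigma tau)
   _ (aT (y :: l)))) => u.
by rewrite [RHS]Bprod_tf; congr (_ + _); rewrite [RHS]mulrAC.
Qed.

Lemma dualvacS L : dualvac L.+1 = scons true (dualvac L).
Proof.
rewrite -[LHS]scons_eta; congr (scons _ _); first by rewrite ffunE.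
by apply/ffunP => i; rewrite !ffunE.
Qed.

Lemma vacS L : vac L.+1 = scons false (vac L).
Proof.
rewrite -[LHS]scons_eta; congr (scons _ _); first by rewrite ffunE.
by apply/ffunP => i; rewrite !ffunE.
Qed.

(** When auxiliary index and row state are both $v_2$, the $R$-matrix leaves both unchanged, with
    weight $a$; hence a left eigenvector of $D$. *)
Lemma monodromyD_dualvac L gamma m x rho :
  monodromy L gamma m x true true (dualvac L) rho
  = (rho == dualvac L)%:R * \prod_(k < L) aw gamma (x - m k).
Proof.
elim: L m rho => [|L IHL] m rho.
  have -> : rho = dualvac 0 by apply/ffunP; case.
  by rewrite monodromy0 big_ord0 mulr1 !eqxx.
rewrite dualvacS -(scons_eta _ rho) monodromyS sum_bool IHL big_ord_recl scons_eq.
by case: (rho ord0); rewrite /Rentry /= !mul0r ?addr0 ?add0r // mulrCA.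
Qed.

Definition Zlist L gamma m l := Bprod L gamma m l (dualvac L) (vac L).

Lemma perm_Zlist L gamma m l1 l2 :
  perm_eq l1 l2 -> Zlist L gamma m l1 = Zlist L gamma m l2.
Proof. by move=> e; rewrite /Zlist (perm_Bprod _ _ _ _ _ e). Qed.

Lemma trigpoly_Zlist L gamma m x l :
  trigpoly (size l) (fun u => Zlist L.+1 gamma (consn u m) (x :: l)).
Proof.
apply: eq_trigpoly (trigpoly_Bprod_tf L gamma m x l (dualvac L) (vac L)) => u.
by rewrite /Zlist dualvacS vacS.
Qed.

(** At $\mu_1=x$ the weight $b(x-\mu_1)$ vanishes, so $B(x)$ must flip the first site; the remaining
    $D$ meets its left eigenvector. *)
Lemma Zlist_rec L gamma m x l :
  Zlist L.+1 gamma (consn x m) (x :: l)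
  = Csinh gamma * (\prod_(y <- l) aw gamma (y - x))
    * (\prod_(k < L) aw gamma (x - m k)) * Zlist L gamma m l.
Proof.
rewrite /Zlist dualvacS vacS Bprod_tf /bw subrr Csinh0 mul0r add0r -!mulrA; congr (_ * (_ * _)).
rewrite /qop_mul (bigD1 (dualvac L)) //= [X in _ + X]big1 ?addr0 => [|r /negPf rd]; last first.
  by rewrite monodromyD_dualvac rd !mul0r.
by rewrite monodromyD_dualvac eqxx mul1r.
Qed.

Lemma ZdwE L gamma mu X :
  Zdw L gamma mu X
  = Zlist L gamma (fun k => mu k.+1) [seq X i.+1 | i : 'I_L].
Proof.
have -> : [seq X i.+1 | i : 'I_L] = [seq X j | j <- index_iota 1 L.+1].
  rewrite /index_iota subSS subn0 (_ : iota 1 L = map S (iota 0 L)); last exact: (iotaDl 1 0 L).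
  by rewrite -val_enum_ord -map_comp -map_comp.
rewrite /Zdw /Zlist unlock.
suff e l : reducebig (qop_id L) l (fun j => BigBody j (qop_mul L) true (Bop L gamma mu (X j)))
           = Bprod L gamma (fun k => mu k.+1) [seq X j | j <- l] by rewrite e.
by elim: l => //= j l <-.
Qed.

(** * The determinant identity and its invariances *)

Lemma det_row0 (F : fieldType) n (A : 'M[F]_n.+1) :
  (forall j, A ord0 (lift ord0 j) = 0) ->
  \det A = A ord0 ord0 * \det (\matrix_(i, j) A (lift ord0 i) (lift ord0 j)).
Proof.
move=> A0; rewrite (expand_det_row _ ord0) big_ord_recl big1 ?addr0 => [|j _].
  rewrite /cofactor expr0 mul1r; congr (_ * \det _).
  by apply/matrixP => i j; rewrite !mxE.
by rewrite A0 mul0r.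
Qed.

Lemma det_scale_rows (F : fieldType) n (d : 'I_n -> F) (A : 'M[F]_n) :
  \det (\matrix_(i, j) (d i * A i j)) = (\prod_i d i) * \det A.
Proof.
have -> : \matrix_(i, j) (d i * A i j) = diag_mx (\row_i d i) *m A.
  by apply/matrixP => i j; rewrite mul_diag_mx !mxE.
by rewrite det_mulmx det_diag; congr (_ * _); apply: eq_bigr => i _; rewrite mxE.
Qed.

Definition evmx n (g : 'I_n -> complex -> complex) (y : 'I_n -> complex) : 'M[complex]_n :=
  \matrix_(i, j) g j (y i).
Arguments evmx {n}.

Definition bprod n (m : nat -> complex) z : complex := \prod_(k < n) Csinh (z - m k).
Definition aprod n gamma (m : nat -> complex) z : complex :=
  \prod_(k < n) Csinh (z - m k + gamma).

(** The difference operator $D$ of the proof idea; [bprod] and [aprod] are its $d$ and $a$. *)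
Definition shiftop n gamma m x0 (f : complex -> complex) z : complex :=
  bprod n m z * Csinh (z - x0) * f z
  + aprod n gamma m z * Csinh (x0 - z + gamma) * f (z - gamma).

Definition Zfun n gamma m (y : 'I_n -> complex) := Zlist n gamma m [seq y i | i : 'I_n].
Arguments Zfun {n}.

Definition Zdet_eq n gamma m x0 (g : 'I_n -> complex -> complex) y :=
  \det (evmx (fun j => shiftop n gamma m x0 (g j)) y)
  = Zfun gamma m y * aprod n gamma m x0 * \det (evmx g y).
Arguments Zdet_eq {n}.

Lemma evmx_mul n (g h : 'I_n -> complex -> complex) (B : 'M[complex]_n) y :
  (forall j z, g j z = \sum_k h k z * B k j) -> evmx g y = evmx h y *m B.
Proof.
move=> gB; apply/matrixP => i j; rewrite !mxE gB.
by apply: eq_bigr => k _; rewrite mxE.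
Qed.

Lemma shiftop_sum n gamma m x0 (I : finType) (h : I -> complex -> complex) (c : I -> complex) f :
  (forall z, f z = \sum_k h k z * c k) ->
  forall z, shiftop n gamma m x0 f z = \sum_k shiftop n gamma m x0 (h k) z * c k.
Proof.
move=> fh z; rewrite /shiftop !fh !mulr_sumr -big_split /=.
by apply: eq_bigr => k _; rewrite mulrDl !mulrA.
Qed.

Section BasisChange.
Variables (n : nat) (gamma : complex) (m : nat -> complex) (x0 : complex).
Variables (g h : 'I_n -> complex -> complex) (B : 'M[complex]_n) (y : 'I_n -> complex).
Hypothesis gB : forall j z, g j z = \sum_k h k z * B k j.

(** [shiftop] is linear, so both sides acquire the same factor $\det B$. *)
Lemma Zdet_eq_span : Zdet_eq gamma m x0 h y -> Zdet_eq gamma m x0 g y.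
Proof.
rewrite /Zdet_eq (evmx_mul _ g h B) // => hE.
rewrite (evmx_mul _ _ (fun k => shiftop n gamma m x0 (h k)) B); last first.
  by move=> j; apply: shiftop_sum.
by rewrite !det_mulmx hE mulrA.
Qed.

Lemma Zdet_eq_basis : \det B != 0 -> Zdet_eq gamma m x0 g y -> Zdet_eq gamma m x0 h y.
Proof.
move=> B0; rewrite /Zdet_eq (evmx_mul _ g h B) //.
rewrite (evmx_mul _ _ (fun k => shiftop n gamma m x0 (h k)) B); last first.
  by move=> j; apply: shiftop_sum.
by rewrite !det_mulmx mulrA => /(mulIf B0).
Qed.

End BasisChange.

Lemma det_evmx_perm n g (y : 'I_n -> complex) (s : 'S_n) :
  \det (evmx g (y \o s)) = (-1) ^+ s * \det (evmx g y).
Proof.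
rewrite -det_perm -det_mulmx -row_permE; congr (\det _).
by apply/matrixP => i j; rewrite !mxE.
Qed.

Lemma Zfun_perm n gamma m (y : 'I_n -> complex) (s : 'S_n) :
  Zfun gamma m (y \o s) = Zfun gamma m y.
Proof.
apply: perm_Zlist; rewrite /image_mem (map_comp y s); apply: perm_map.
apply: uniq_perm; rewrite ?enum_uniq ?(map_inj_uniq (@perm_inj _ s)) ?enum_uniq // => i.
rewrite mem_enum -[i](permKV s); apply/mapP; exists (s^-1%g i) => //.
by rewrite mem_enum.
Qed.

(** Both determinants acquire the sign of [s] and $Z$ is symmetric; thus any [y i] can be moved to
    the front. *)
Lemma Zdet_eq_perm n gamma m x0 g (y : 'I_n -> complex) (s : 'S_n) :
  Zdet_eq gamma m x0 g (y \o s) -> Zdet_eq gamma m x0 g y.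
Proof.
rewrite /Zdet_eq !det_evmx_perm Zfun_perm mulrCA.
by move/(mulfI (negbT (signr_eq0 _ s))).
Qed.

(** * Bases of trigonometric polynomials *)

(** For $n>0$ this is $e^{(2j-n+1)z}$; the indices $j<n$ give the monomial basis in degree $n-1$. *)
Definition phi n (j : nat) (z : complex) : complex := Cexp z ^+ j.*2 / Cexp z ^+ n.-1.

Lemma phi_span n f : trigpoly n f ->
  exists c : 'I_n.+1 -> complex, forall z, f z = \sum_(k < n.+1) phi n.+1 k z * c k.
Proof.
move=> [p sp fp]; exists (fun k => p`_k) => z.
rewrite fp (horner_coef_wide _ sp) mulr_suml; apply: eq_bigr => k _.
by rewrite /phi -mul2n exprM [RHS]mulrC mulrA.
Qed.

(* A basis of the trigonometric polynomials of degree [n] all of whose members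
   but the first vanish at [w]. *)
Definition hbasis n w (j : 'I_n.+1) (z : complex) : complex :=
  if unlift ord0 j is Some j' then Csinh (z - w) * phi n j' z else phi n.+1 0 z.
Arguments hbasis : clear implicits.

(** The coefficients of [hbasis] in the monomials [phi]. Multiplying a monomial by $\sinh(z-w)$
    gives two neighbouring monomials, so the matrix is upper bidiagonal. *)
Definition hmx n w : 'M[complex]_n.+1 := \matrix_(k, j)
  if unlift ord0 j is Some j' then
    (k == j'.+1 :> nat)%:R * ((Cexp w)^-1 / 2%:R) - (k == j' :> nat)%:R * (Cexp w / 2%:R)
  else (k == ord0)%:R.

Lemma hbasis0 n w : hbasis n w ord0 = phi n.+1 0.
Proof. by apply: functional_extensionality => z; rewrite /hbasis unlift_none. Qed.

Lemma hbasisS n w j z : hbasis n w (lift ord0 j) z = Csinh (z - w) * phi n j z.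
Proof. by rewrite /hbasis liftK. Qed.

Lemma sum_delta n (F : nat -> complex) (i : nat) c : (i < n)%N ->
  \sum_(k < n) F k * ((k == i :> nat)%:R * c) = F i * c.
Proof.
move=> ni; rewrite (bigD1 (Ordinal ni)) //= eqxx mul1r big1 ?addr0 // => k /negPf ki.
by rewrite (_ : (k == i :> nat) = false) ?mul0r ?mulr0.
Qed.

Lemma hbasis_phi n w j z : hbasis n w j z = \sum_(k < n.+1) phi n.+1 k z * hmx n w k j.
Proof.
rewrite /hbasis; case: unliftP => [j'|] ->.
  under eq_bigr => k _ do rewrite mxE liftK mulrBr.
  have jn := ltn_ord j'.
  rewrite sumrB !(sum_delta _ (fun k => phi n.+1 k z)) //; last exact: ltnW.
  rewrite /phi CsinhE CexpB; case: n j' jn {j} => [|n] j' _ /=; first by case: j'.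
  have z0 := Cexp_neq0 z; have w0 := Cexp_neq0 w; have c2 := complex2_neq0.
  by rewrite doubleS !exprS; field; rewrite ?(z0, w0, c2, expf_neq0).
under eq_bigr => k _ do rewrite mxE unlift_none -[(_ == _)%:R]mulr1.
by rewrite (sum_delta _ (fun k => phi n.+1 k z) 0) // mulr1.
Qed.

Lemma det_hmx n w : \det (hmx n w) = ((Cexp w)^-1 / 2%:R) ^+ n.
Proof.
rewrite -det_tr det_trig; last first.
  apply/is_trig_mxP => i k ik; rewrite !mxE; case: unliftP ik => [i'|] -> ik.
    rewrite lift0 in ik.
    by rewrite !gtn_eqF ?mul0r ?subrr // (ltn_trans _ ik).
  by rewrite -val_eqE /= gtn_eqF.
rewrite big_ord_recl !mxE unlift_none eqxx mul1r (eq_bigr (fun=> (Cexp w)^-1 / 2%:R)).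
  by rewrite prodr_const card_ord.
by move=> i _; rewrite !mxE liftK lift0 eqxx mul1r gtn_eqF // mul0r subr0.
Qed.

Lemma det_hmx_neq0 n w : \det (hmx n w) != 0.
Proof.
by rewrite det_hmx expf_neq0 // mulf_neq0 ?invr_neq0 ?Cexp_neq0 ?complex2_neq0.
Qed.

(** For the parameter [y ord0] the first row has a single nonzero entry and can be expanded. Passing
    to [w] only changes the factor $\det$ [hmx]. *)
Lemma det_ev_hbasis n w (y : 'I_n.+1 -> complex) :
  let y' i := y (lift ord0 i) in
  \det (evmx (hbasis n w) y)
  = phi n.+1 0 w * (\prod_(i < n) Csinh (y' i - y ord0)) * \det (evmx (fun j : 'I_n => phi n j) y').
Proof.
move=> y'.
have det_h v : \det (evmx (hbasis n v) y)
    = \det (evmx (fun j : 'I_n.+1 => phi n.+1 j) y) * ((Cexp v)^-1 / 2%:R) ^+ n.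
  by rewrite -det_hmx -det_mulmx; congr (\det _); apply: evmx_mul => j z; apply: hbasis_phi.
have := det_h (y ord0); rewrite [LHS]det_row0; last first.
  by move=> j; rewrite mxE hbasisS subrr Csinh0 mul0r.
rewrite mxE hbasis0.
have -> : \matrix_(i, j) evmx (hbasis n (y ord0)) y (lift ord0 i) (lift ord0 j)
    = \matrix_(i, j) (Csinh (y' i - y ord0) * evmx (fun j : 'I_n => phi n j) y' i j).
  by apply/matrixP => i j; rewrite !mxE hbasisS.
rewrite det_scale_rows => e; rewrite det_h.
have y0 := Cexp_neq0 (y ord0); have w0 := Cexp_neq0 w; have c2 := complex2_neq0.
have -> : ((Cexp w)^-1 / 2%:R) ^+ n
    = ((Cexp (y ord0))^-1 / 2%:R) ^+ n * (Cexp (y ord0) / Cexp w) ^+ n.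
  by rewrite -exprMn; congr (_ ^+ n); field; rewrite y0 w0 c2.
rewrite mulrA -e /phi /= !expr0 !mul1r expr_div_n.
by field; rewrite !expf_neq0.
Qed.

(** * Proof of the determinant identity by interpolation *)

Lemma Zdet_eq_rec n gamma m x0 (y : 'I_n.+1 -> complex) :
  Zdet_eq gamma m x0 (fun j : 'I_n => phi n j) (fun i => y (lift ord0 i)) ->
  Zdet_eq gamma (consn (y ord0) m) x0 (fun j : 'I_n.+1 => phi n.+1 j) y.
Proof.
set y' := (fun i => y (lift ord0 i)) => IH.
(* Since $d$ vanishes at [y ord0], the operator there reads its argument only at [w]; the first row
   then has one nonzero entry. *)
pose w := y ord0 - gamma.
apply: (Zdet_eq_basis _ _ _ _ _ _ _ _ (hbasis_phi n w) (det_hmx_neq0 n w)).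
have dS z : bprod n.+1 (consn (y ord0) m) z = Csinh (z - y ord0) * bprod n m z.
  by rewrite /bprod big_ord_recl.
have aS z : aprod n.+1 gamma (consn (y ord0) m) z
    = Csinh (z - y ord0 + gamma) * aprod n gamma m z.
  by rewrite /aprod big_ord_recl.
rewrite /Zdet_eq [LHS]det_row0; last first.
  move=> j; rewrite mxE /shiftop hbasisS dS subrr Csinh0 !mul0r add0r.
  by rewrite hbasisS subrr Csinh0 mul0r mulr0.
rewrite mxE /shiftop hbasis0 dS aS subrr add0r Csinh0 !mul0r add0r.
set M := \matrix_(i, j) _.
(* The factor $\sinh(z-w)$, read at $z$ and at $z-\gamma$, complements the first factors of $d$ and
   $a$, so both terms carry the same product and the smaller operator remains. *)
have {M}-> : M = \matrix_(i, j) (Csinh (y' i - y ord0) * Csinh (y' i - y ord0 + gamma)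
     * evmx (fun j : 'I_n => shiftop n gamma m x0 (phi n j)) y' i j).
  apply/matrixP => i j; rewrite !mxE /shiftop !hbasisS dS aS -/(y' i).
  have -> : y' i - w = y' i - y ord0 + gamma by rewrite /w; ring.
  have -> : y' i - gamma - w = y' i - y ord0 by rewrite /w; ring.
  by ring.
rewrite det_scale_rows big_split /= IH det_ev_hbasis -/y'.
have -> : Zfun gamma (consn (y ord0) m) y
    = Csinh gamma * (\prod_(i < n) Csinh (y' i - y ord0 + gamma))
      * aprod n gamma m (y ord0) * Zfun gamma m y'.
  rewrite /Zfun /image_mem enum_ordSl /= Zlist_rec -map_comp /aprod.
  by rewrite big_map big_enum.
by rewrite aS; ring.
Qed.

(** Provides points to the right of a given finite set, where [Csinh_neq0] applies. *)
Lemma Re_bound (s : seq complex) : exists r, forall z, z \in s -> Rle (Re z) r.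
Proof.
elim: s => [|x s [r sr]]; first by exists R0.
exists (Rmax (Re x) r) => z; rewrite inE => /predU1P[->|/sr]; first exact: Rmax_l.
by move/Rle_trans; apply; exact: Rmax_r.
Qed.

Lemma ReB (z w : complex) : Re (z - w) = Rminus (Re z) (Re w).
Proof. by case: z w => [a b] [c d]. Qed.

Lemma trigpoly_aprod n gamma m : trigpoly n (aprod n gamma m).
Proof.
apply: (trigpoly_prod_ord n (fun k z => Csinh (z - m k + gamma))) => k.
by apply: eq_trigpoly (trigpoly_sinh_add (gamma - m k)) => z; rewrite addrCA addrC addrAC.
Qed.

Lemma aprod_neq0 n gamma m : exists z, aprod n gamma m z != 0.
Proof.
have [r rP] := Re_bound [seq m k - gamma | k : 'I_n].
exists (Cplx (Rplus r R1) R0); apply/prodf_neq0 => k _; apply: Csinh_neq0.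
have /rP : m k - gamma \in [seq m k - gamma | k : 'I_n] by apply/imageP; exists k.
have -> : forall u : complex, u - m k + gamma = u - (m k - gamma) by move=> u; ring.
rewrite ReB /=; lra.
Qed.

(* The product [aprod n gamma m] over the other sites is a trigonometric polynomial
   of degree [n] killed by the operator when the first inhomogeneity is [x0 + gamma]. *)
Lemma det_shiftop_kernel n gamma m x0 (y : 'I_n.+1 -> complex) :
  \det (evmx (fun j : 'I_n.+1 =>
    shiftop n.+1 gamma (consn (x0 + gamma) m) x0 (phi n.+1 j)) y) = 0.
Proof.
(* The coefficients of [aprod n gamma m] form the kernel vector. *)
have [c rc] := phi_span _ _ (trigpoly_aprod n gamma m).
apply/eqP; rewrite -det_tr; apply/det0P; exists (\row_j c j).
  have [z] := aprod_neq0 n gamma m; apply: contraNneq => c0.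
  rewrite rc big1 // => j _; have := congr1 (fun v : 'rV_n.+1 => v ord0 j) c0.
  by rewrite !mxE => ->; rewrite mulr0.
apply/rowP => i; rewrite !mxE.
under eq_bigr => j _ do rewrite !mxE mulrC.
rewrite -(shiftop_sum _ _ _ _ _ (fun j : 'I_n.+1 => phi n.+1 j) c _ rc) /shiftop.
have -> z : bprod n.+1 (consn (x0 + gamma) m) z = Csinh (z - (x0 + gamma)) * bprod n m z.
  by rewrite /bprod big_ord_recl.
have -> z : aprod n.+1 gamma (consn (x0 + gamma) m) z
    = Csinh (z - (x0 + gamma) + gamma) * aprod n gamma m z.
  by rewrite /aprod big_ord_recl.
(* The shift by $\gamma$ turns $a$ into $d$, so the two terms of the operator cancel. *)
have -> z : aprod n gamma m (z - gamma) = bprod n m z.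
  by apply: eq_bigr => k _; congr Csinh; ring.
move: (y i) => z.
have -> : x0 - z + gamma = - (z - (x0 + gamma)) by ring.
have -> : z - (x0 + gamma) + gamma = z - x0 by ring.
by rewrite CsinhN; ring.
Qed.

Lemma trigpoly_Zfun n gamma m (y : 'I_n.+1 -> complex) :
  trigpoly n (fun u => Zfun gamma (consn u m) y).
Proof.
have := trigpoly_Zlist n gamma m (y ord0) [seq y (lift ord0 i) | i : 'I_n].
rewrite size_image card_ord; apply: eq_trigpoly => u.
by rewrite /Zfun /image_mem enum_ordSl /= -map_comp.
Qed.

(** The second hypothesis separates the node $x_0+\gamma$ from the nodes [y i]. *)
Lemma Zdet_eq_phi_generic n gamma m x0 (y : 'I_n -> complex) :
  (forall i j, i != j -> Csinh (y i - y j) != 0) ->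
  (forall i, Csinh (x0 - y i + gamma) != 0) ->
  Zdet_eq gamma m x0 (fun j : 'I_n => phi n j) y.
Proof.
elim: n m y => [|n IHn] m y y_inj yx0.
  rewrite /Zdet_eq !det_mx00 mulr1 /aprod big_ord0 mulr1 /Zfun /Zlist.
  rewrite (size0nil (s := [seq y i | i : 'I_0])) ?size_image ?card_ord //=.
  by rewrite /qop_id (_ : _ == _) //; apply/eqP/ffunP; case.
have -> : m = consn (m 0%N) (fun k => m k.+1).
  by apply: functional_extensionality; case.
move: (m 0%N) (fun k => m k.+1) => u {}m.
apply/eqP; rewrite -subr_eq0; apply/eqP.
(* Degree $n+1$ in [u]: each entry on the left has degree one; on the right $Z$ has degree $n$ and
   [aprod] degree one. *)
pose F u := \det (evmx (fun j : 'I_n.+1 => shiftop n.+1 gamma (consn u m) x0 (phi n.+1 j)) y)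
  - Zfun gamma (consn u m) y * aprod n.+1 gamma (consn u m) x0
    * \det (evmx (fun j : 'I_n.+1 => phi n.+1 j) y).
have aT z : trigpoly 1 (fun u => Csinh (z - u + gamma)).
  by apply: eq_trigpoly (trigpoly_sinh_sub (z + gamma)) => v; rewrite addrAC.
have dS v z : bprod n.+1 (consn v m) z = Csinh (z - v) * bprod n m z.
  by rewrite /bprod big_ord_recl.
have aS v z : aprod n.+1 gamma (consn v m) z = Csinh (z - v + gamma) * aprod n gamma m z.
  by rewrite /aprod big_ord_recl.
have FT : trigpoly n.+1 F.
  apply: trigpolyD.
    apply: trigpoly_det => i j.
    apply: eq_trigpoly (trigpolyD _ _ _
      (trigpolyZ _ (bprod n m (y i) * Csinh (y i - x0) * phi n.+1 j (y i)) _
        (trigpoly_sinh_sub (y i)))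
      (trigpolyZ _ (aprod n gamma m (y i) * Csinh (x0 - y i + gamma)
         * phi n.+1 j (y i - gamma)) _ (aT (y i)))) => v.
    by rewrite mxE /shiftop dS aS; ring.
  have := trigpolyZ _ (aprod n gamma m x0 * \det (evmx (fun j : 'I_n.+1 => phi n.+1 j) y))
    _ (trigpolyM _ _ _ _ (trigpoly_Zfun n gamma m y) (aT x0)).
  rewrite addn1 => /trigpolyN; apply: eq_trigpoly => v.
  by rewrite aS; ring.
apply: (trigpoly_eq0 _ F (x0 + gamma :: [seq y i | i : 'I_n.+1]) FT); last first.
- move=> v; rewrite inE => /predU1P [->|/imageP [i _ ->]].
    rewrite /F det_shiftop_kernel aS.
    have -> : x0 - (x0 + gamma) + gamma = 0 by ring.
    by rewrite Csinh0 !(mul0r, mulr0) subrr.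
  (* A transposition brings [y i] to the front, where the recursion applies. *)
  apply/eqP; rewrite subr_eq0; apply/eqP; apply: (Zdet_eq_perm _ _ _ _ _ _ (tperm ord0 i)).
  have e : y i = (y \o tperm ord0 i) ord0 by rewrite /= tpermL.
  rewrite e; apply: Zdet_eq_rec; apply: IHn => [j k jk|j]; last exact: yx0.
  by apply: y_inj; rewrite (inj_eq perm_inj) (inj_eq (@lift_inj _ _)).
- by rewrite /= size_image card_ord.
rewrite /= -map_comp map_inj_uniq ?enum_uniq ?andbT.
  apply/mapP => -[i _ /= /exp2_eq/eqP].
  have -> : x0 + gamma - y i = x0 - y i + gamma by ring.
  by rewrite (negPf (yx0 i)).
move=> i j /exp2_eq/eqP; apply: contraTeq => ij; exact: y_inj.
Qed.

Lemma Zdet_eq_phi n gamma m x0 (y : 'I_n -> complex) :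
  (forall i j, i != j -> Csinh (y i - y j) != 0) ->
  Zdet_eq gamma m x0 (fun j : 'I_n => phi n j) y.
Proof.
move=> y_inj; apply/eqP; rewrite -subr_eq0; apply/eqP.
pose F x0 := \det (evmx (fun j : 'I_n => shiftop n gamma m x0 (phi n j)) y)
  - Zfun gamma m y * aprod n gamma m x0 * \det (evmx (fun j : 'I_n => phi n j) y).
have FT : trigpoly n F.
  apply: trigpolyD.
    apply: trigpoly_det => i j.
    apply: eq_trigpoly (trigpolyD _ _ _
      (trigpolyZ _ (bprod n m (y i) * phi n j (y i)) _ (trigpoly_sinh_sub (y i)))
      (trigpolyZ _ (aprod n gamma m (y i) * phi n j (y i - gamma)) _
        (trigpoly_sinh_add (gamma - y i)))) => v.
    rewrite mxE /shiftop (_ : v + (gamma - y i) = v - y i + gamma); last by ring.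
    by ring.
  have := trigpolyZ _ (Zfun gamma m y * \det (evmx (fun j : 'I_n => phi n j) y))
    _ (trigpoly_aprod n gamma m).
  by move/trigpolyN; apply: eq_trigpoly => v; ring.
have [r rP] := Re_bound [seq y i - gamma | i : 'I_n].
(* These $n+1$ values of $x_0$ have distinct real parts exceeding those of all $y_i-\gamma$, so the
   generic case covers them. *)
pose pt (k : nat) := Cplx (Rplus r (INR k.+1)) R0.
apply: (trigpoly_eq0 _ F [seq pt k | k <- iota 0 n.+1] FT).
- rewrite -map_comp map_inj_in_uniq ?iota_uniq // => i j _ _ /exp2_eq e.
  have pt_neq k l : (k < l)%N -> Csinh (pt l - pt k) != 0.
    move=> kl; apply: Csinh_neq0; rewrite ReB /pt /Re.
    have := lt_INR k.+1 l.+1 (ltP (kl : k.+1 < l.+1)%N); lra.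
  case: (ltngtP i j) => // /pt_neq/eqP; last by rewrite e.
  by rewrite -opprB CsinhN e oppr0.
- by rewrite size_map size_iota.
move=> v /mapP [k _ ->]; apply/eqP; rewrite subr_eq0; apply/eqP.
apply: Zdet_eq_phi_generic => // i; apply: Csinh_neq0.
have /rP : y i - gamma \in [seq y i - gamma | i : 'I_n] by apply/imageP; exists i.
have -> : pt k - y i + gamma = pt k - (y i - gamma) by ring.
move=> yr; rewrite ReB -[Re (pt k)]/(Rplus r (INR k.+1)) S_INR.
by have := pos_INR k; lra.
Qed.

Lemma Zdet_eq_trigpoly n gamma m x0 (g : 'I_n.+1 -> complex -> complex) y :
  (forall i j, i != j -> Csinh (y i - y j) != 0) ->
  (forall j, trigpoly n (g j)) -> Zdet_eq gamma m x0 g y.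
Proof.
move=> y_inj gT.
have [c cP] := fin_all_exists (fun j => phi_span n (g j) (gT j)).
apply: (Zdet_eq_span _ _ _ _ _ (fun j : 'I_n.+1 => phi n.+1 j) (\matrix_(k, j) c j k)).
  by move=> j z; rewrite cP; apply: eq_bigr => k _; rewrite mxE.
exact: Zdet_eq_phi.
Qed.

(** * Nodal polynomials and the matrices $V$, $V_i$ *)

(** A permutation that fixes every index but [i] is the identity. At $X_i^0$ the matrix of nodal
    values has this shape. *)
Lemma det_diag_but1 (F : fieldType) n (i : 'I_n) (A : 'M[F]_n) :
  (forall k j, k != i -> j != k -> A k j = 0) -> \det A = \prod_k A k k.
Proof.
move=> A0; rewrite /determinant (bigD1 1%g) //= [X in _ + X]big1 ?addr0 => [|s s1].
  by rewrite odd_perm1 mul1r; apply: eq_bigr => k _; rewrite perm1.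
suff [k ki sk] : exists2 k, k != i & s k != k.
  by rewrite (bigD1 k) //= A0 // mul0r mulr0.
apply/exists_inP; apply: contraNT s1 => /exists_inPn sF.
have {}sF k : k != i -> s k = k by move/sF; rewrite negbK => /eqP.
apply/eqP/permP => k; rewrite perm1; have [->|/sF //] := eqVneq k i.
apply/eqP/negPn/negP => si; have := sF _ si.
by move/perm_inj/eqP; apply/negP.
Qed.

Lemma prod_nat_recl (L : nat) (P : pred nat) (Q : pred 'I_L) (F : nat -> complex) :
  P 0%N -> (forall k : 'I_L, P k.+1 = Q k) ->
  \prod_(0 <= k < L.+1 | P k) F k = F 0%N * \prod_(k < L | Q k) F k.+1.
Proof.
move=> P0 PQ; rewrite big_mkord big_mkcond big_ord_recl /= P0; congr (_ * _).
by rewrite [RHS]big_mkcond; apply: eq_bigr => k _; rewrite -PQ.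
Qed.

(** Matches the ratios $a/b$ of $V$, in $x_k-z$, with nodal products in $z-x_k$, keeping the sign
    inside each factor. *)
Lemma prod_ratio_opp (I : finType) (P : pred I) (F G : I -> complex) :
  (forall i, P i -> G i != 0) ->
  (\prod_(i | P i) (F i / G i)) * \prod_(i | P i) - G i = \prod_(i | P i) - F i.
Proof.
move=> G0; rewrite -big_split /=; apply: eq_bigr => i /G0 Gi.
by rewrite mulrN divfK.
Qed.

Definition nodal L (x : nat -> complex) (be : 'I_L) z : complex :=
  \prod_(k < L | k != be) Csinh (z - x k.+1).
Arguments nodal {L}.

Lemma trigpoly_nodal n x (be : 'I_n.+1) : trigpoly n (nodal x be).
Proof.
have := trigpoly_prod _ (index_enum 'I_n.+1) (fun k => k != be)
  (fun k z => Csinh (z - x k.+1)) (fun k _ => trigpoly_sinh_add (- x k.+1)).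
rewrite (_ : count _ _ = n) //.
have := count_predC (pred1 be) (index_enum 'I_n.+1).
rewrite (count_uniq_mem _ (index_enum_uniq _)) mem_index_enum -[index_enum _]enumT size_enum_ord.
by case.
Qed.

Lemma nodal_eq0 L x (al be : 'I_L) : al != be -> nodal x be (x al.+1) = 0.
Proof. by move=> ab; rewrite /nodal (bigD1 al) //= subrr Csinh0 mul0r. Qed.

Lemma nodal_shift L gamma x (be : 'I_L) z :
  nodal x be (z - gamma) = \prod_(k < L | k != be) - aw gamma (x k.+1 - z).
Proof.
apply: eq_bigr => k _; rewrite /aw -CsinhN; congr Csinh; ring.
Qed.

Lemma nodal_opp L x (be : 'I_L) z :
  nodal x be z = \prod_(k < L | k != be) - bw (x k.+1 - z).
Proof. by apply: eq_bigr => k _; rewrite /bw -CsinhN opprB. Qed.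

Lemma Zdet_eq_nodal L gamma m x0 x (i : 'I_L) (y : 'I_L -> complex) :
  (forall j k, j != k -> Csinh (y j - y k) != 0) -> Zdet_eq gamma m x0 (nodal x) y.
Proof.
case: L i y => [[]//|n] _ y y_inj.
by apply: Zdet_eq_trigpoly => // j; apply: trigpoly_nodal.
Qed.

Section Determinants.
Variables (L : nat) (gamma : complex) (mu x : nat -> complex).
Hypothesis x_inj : forall j k : nat, (j <= L)%N -> (k <= L)%N -> j != k -> bw (x j - x k) != 0.
Let m k := mu k.+1.

Lemma bw_neq0S (k : 'I_L) z : (z <= L)%N -> k.+1 != z -> bw (x k.+1 - x z) != 0.
Proof. by move=> zL kz; apply: x_inj => //; exact: ltn_ord. Qed.

Lemma prod_aw z : \prod_(1 <= k < L.+1) aw gamma (z - mu k) = aprod L gamma m z.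
Proof. by rewrite big_add1 big_mkord. Qed.

(** On the diagonal the two terms of the operator give the two terms of $V$; off it the nodal
    polynomial vanishes at $x_\alpha$ and only the shifted term remains. The $k=0$ ratio in $V$
    comes from the factor in $x_0$. *)
Lemma shiftop_nodal_Vmx (al be : 'I_L) :
  shiftop L gamma m (x 0%N) (nodal x be) (x al.+1)
  = bw (x al.+1 - x 0%N) * nodal x al (x al.+1) * Vmx L gamma mu x be al.
Proof.
have b0 : bw (x 0%N - x al.+1) != 0 by apply: x_inj => //; exact: ltn_ord.
have bS (k : 'I_L) : k != al -> bw (x k.+1 - x al.+1) != 0.
  by move=> kal; apply: bw_neq0S; rewrite ?eqSS //; exact: ltn_ord.
have bN : bw (x al.+1 - x 0%N) = - bw (x 0%N - x al.+1) by rewrite /bw -CsinhN opprB.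
rewrite /shiftop nodal_shift mxE /= eqSS prod_aw bN.
have [->|beal] := eqVneq be al.
  rewrite eqxx (prod_nat_recl _ _ (fun k => k != al)) // big_add1 big_mkord -/(bprod L m _) mulrBr.
  have <- := prod_ratio_opp _ (fun k : 'I_L => k != al)
     (fun k => aw gamma (x k.+1 - x al.+1)) _ bS.
  rewrite -nodal_opp -[Csinh (x al.+1 - _)]/(bw _) bN -[Csinh (_ + gamma)]/(aw gamma _).
  by field.
have albe : al != be by rewrite eq_sym.
have -> : (be == al :> nat) = false by exact: negPf beal.
rewrite (nodal_eq0 _ _ _ _ albe) mulr0 add0r prod_aw.
rewrite (prod_nat_recl _ _ (fun k => (k != be) && (k != al))) //.
rewrite -[Csinh (_ + gamma)]/(aw gamma _).
(* Isolates the factor $k=\beta$, which cancels the denominator in $V$, and the factor $k=\alpha$ of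
   the shifted product, which is $a(0)=c$. *)
rewrite (nodal_opp _ _ al) [in RHS](bigD1 be) //= (bigD1 al) //=.
have aw0 : aw gamma (x al.+1 - x al.+1) = cw gamma 0 by rewrite /aw subrr add0r.
have PC : (fun k : 'I_L => (k != al) && (k != be)) =1 (fun k => (k != be) && (k != al)).
  by move=> k; rewrite andbC.
rewrite aw0 (eq_bigl _ _ PC).
have bbe := bS be beal.
have <- := prod_ratio_opp _ (fun k : 'I_L => (k != be) && (k != al))
     (fun k => aw gamma (x k.+1 - x al.+1)) (fun k => bw (x k.+1 - x al.+1)).
  have -> : bw (x al.+1 - x be.+1) = - bw (x be.+1 - x al.+1) by rewrite /bw -CsinhN opprB.
  rewrite -[cw _ (_ - _)]/(cw gamma 0).
  by field; rewrite ?oppr_eq0 ?bbe ?b0.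
by move=> k /andP[_ /bS].
Qed.

(** At $z=x_0$ the unshifted term vanishes and the factor $\sinh(x_0-z+\gamma)$ equals $c$. *)
Lemma shiftop_nodal_Vimx (i be : 'I_L) :
  shiftop L gamma m (x 0%N) (nodal x be) (x 0%N)
  = bw (x i.+1 - x 0%N) * nodal x i (x 0%N) * Vimx L gamma mu x i.+1 be i.
Proof.
have bS (k : 'I_L) : bw (x k.+1 - x 0%N) != 0 by apply: bw_neq0S.
rewrite /shiftop nodal_shift subrr Csinh0 mulr0 mul0r add0r add0r mxE /= eqxx prod_aw.
(* Both sides are minus the full product over [k], whichever factor is singled out. *)
have -> : bw (x i.+1 - x 0%N) * nodal x i (x 0%N)
    = bw (x be.+1 - x 0%N) * \prod_(k < L | k != be) - bw (x k.+1 - x 0%N).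
  have bD (j : 'I_L) : bw (x j.+1 - x 0%N) * \prod_(k < L | k != j) - bw (x k.+1 - x 0%N)
            = - \prod_(k < L) - bw (x k.+1 - x 0%N).
    by rewrite [in RHS](bigD1 j) //= mulNr opprK.
  by rewrite nodal_opp !bD.
rewrite big_add1 big_mkord.
have <- := prod_ratio_opp _ (fun k : 'I_L => k != be)
     (fun k => aw gamma (x k.+1 - x 0%N)) (fun k => bw (x k.+1 - x 0%N)) (fun k _ => bS k).
have bbe := bS be.
by rewrite -[cw _ _]/(Csinh gamma); field.
Qed.

(* The common end of the two evaluations: [y] is [X] or [X_i^0] and [V] the
   corresponding matrix. *)
Lemma Zfun_det (y G : 'I_L -> complex) (V : 'M[complex]_L) (i : 'I_L) :
  (forall k : nat, (1 <= k <= L)%N -> aw gamma (x 0%N - mu k) != 0) ->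
  (forall j k, j != k -> Csinh (y j - y k) != 0) ->
  (forall al be, shiftop L gamma m (x 0%N) (nodal x be) (y al)
     = bw (x al.+1 - x 0%N) * G al * V be al) ->
  (forall al, nodal x al (y al) = G al) -> (forall al, G al != 0) ->
  (forall al be, al != i -> be != al -> nodal x be (y al) = 0) ->
  Zfun gamma m y = \det V * prefactor L gamma mu x.
Proof.
move=> a0 y_inj yV yG G0 yi.
have := Zdet_eq_nodal L gamma m (x 0%N) x i y y_inj; rewrite /Zdet_eq.
have -> : evmx (fun j => shiftop L gamma m (x 0%N) (nodal x j)) y
    = \matrix_(al, be) (bw (x al.+1 - x 0%N) * G al * V^T al be).
  by apply/matrixP => al be; rewrite !mxE yV.
rewrite det_scale_rows det_tr big_split /=.
(* The nodal determinant is the product of the [G k], which cancels against the row factors on the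
   left. *)
rewrite (det_diag_but1 _ _ i (evmx _ _)); last by move=> al be ai ba; rewrite mxE yi.
under [X in _ = _ * X -> _]eq_bigr => k _ do rewrite mxE yG.
have PG : \prod_k G k != 0 by apply/prodf_neq0 => k _.
have Pa : aprod L gamma m (x 0%N) != 0.
  by apply/prodf_neq0 => k _; apply: a0; rewrite /= ltn_ord.
rewrite mulrAC => /(mulIf PG) e.
rewrite /prefactor big_add1 big_mkord big_split /= prodfV -[X in _ / X]/(aprod L gamma m (x 0%N)).
by rewrite mulrA [\det V * _]mulrC e mulfK.
Qed.

End Determinants.

Theorem theorem6p2 (L : nat) (gamma : complex) (mu x : nat -> complex) :
  (0 < L)%N ->
  (* genericity of x_0, x_1, ..., x_L *)
  (forall j k : nat, (j <= L)%N -> (k <= L)%N -> j != k ->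
     bw (x j - x k) != 0) ->
  (forall k : nat, (1 <= k <= L)%N -> aw gamma (x 0%N - mu k) != 0) ->
  Zdw L gamma mu x = \det (Vmx L gamma mu x) * prefactor L gamma mu x
  /\ (forall i : nat, (1 <= i <= L)%N ->
        Zdw L gamma mu (replace0 x i)
        = \det (Vimx L gamma mu x i) * prefactor L gamma mu x).
Proof.
move=> L0 x_inj a0.
have xS (j k : 'I_L) : j != k -> bw (x j.+1 - x k.+1) != 0.
  by move=> jk; apply: x_inj; rewrite ?eqSS //; exact: ltn_ord.
have xS0 (j : 'I_L) : bw (x j.+1 - x 0%N) != 0 by apply: x_inj => //; exact: ltn_ord.
have x0S (j : 'I_L) : bw (x 0%N - x j.+1) != 0 by apply: x_inj => //; exact: ltn_ord.
have GX (al : 'I_L) : nodal x al (x al.+1) != 0.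
  by apply/prodf_neq0 => k kal; apply: xS; rewrite eq_sym.
split.
  (* At $X$ the nodal matrix is diagonal, so any index can serve as the exceptional row. *)
  rewrite ZdwE; apply: (Zfun_det L gamma mu x (fun al : 'I_L => x al.+1)
      (fun al => nodal x al (x al.+1)) _ (Ordinal L0) a0 xS) => //.
    by move=> al be; apply: shiftop_nodal_Vmx.
  by move=> al be _ ba; apply: nodal_eq0; rewrite eq_sym.
case=> // i /= iL; rewrite ZdwE; pose i' := Ordinal iL.
have yE (al : 'I_L) : replace0 x i.+1 al.+1 = if al == i' then x 0%N else x al.+1.
  by rewrite /replace0 eqSS.
apply: (Zfun_det L gamma mu x (fun al : 'I_L => replace0 x i.+1 al.+1)
  (fun al => nodal x al (replace0 x i.+1 al.+1)) _ i' a0) => //.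
- move=> j k; rewrite !yE; case: (eqVneq j i') => [->|ji]; case: (eqVneq k i') => // ki jk.
  exact: xS.
- move=> al be; rewrite yE; case: (eqVneq al i') => [->|ali].
    exact: (shiftop_nodal_Vimx L gamma mu x x_inj i' be).
  (* Points other than the replaced one correspond to the columns in which $V_i$ and $V$ agree. *)
  rewrite shiftop_nodal_Vmx //; congr (_ * _).
  by rewrite [RHS]mxE /= eqSS (_ : (al == i :> nat) = false) //; apply: negPf ali.
- move=> al; rewrite yE; case: (eqVneq al i') => // ->.
  by apply/prodf_neq0 => k _; apply: x0S.
move=> al be ali ba; rewrite yE (negPf ali).
by apply: nodal_eq0; rewrite eq_sym.
Qed.
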